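(* Let $\theta=(W_L,W_{L-1},\ldots,W_1)$ be a weight vector (with $W_j\in\mathbb{R}^{d_j\times d_{j-1}}$) representing a linear neural network. For $L\ge k\ge i\ge 0$ let $$\omega_{ki}=\operatorname{rk}W_{k\sim i}-\operatorname{rk}W_{k\sim i-1}-\operatorname{rk}W_{k+1\sim i}+\operatorname{rk}W_{k+1\sim i-1}.$$ Then there exist, for all $L\ge k\ge j\ge i\ge 0$, subspaces $a_{kji}$ and $b_{kji}$ of $\mathbb{R}^{d_j}$, each of dimension $\omega_{ki}$, such that: (1) for every $j\in[0,L]$, $\mathcal{A}_j=\{a_{kji}\ne\{\mathbf 0\}:k\in[j,L],i\in[0,j]\}$ is a direct sum decomposition of $\mathbb{R}^{d_j}$, and $\mathcal{B}_j=\{b_{kji}\ne\{\mathbf 0\}:k\in[j,L],i\in[0,j]\}$ is also a direct sum decomposition of $\mathbb{R}^{d_j}$; (2) (flow conditions) for $j\in[1,L]$, $$W_j\,a_{k,j-1,i}=\begin{cases}a_{kji},&k\ge j,\\ \{\mathbf 0\},&k=j-1,\end{cases}\qquad W_j^\top b_{kji}=\begin{cases}b_{k,j-1,i},&j>i,\\ \{\mathbf 0\},&j=i.\end{cases}$$ Moreover, for every $j\in[0,L]$, $$A_{kji}:=\operatorname{null}W_{k+1\sim j}\cap\operatorname{col}W_{j\sim i}=\bigoplus_{t=j}^{k}\bigoplus_{s=0}^{i}a_{tjs},\qquad k\in[j-1,L],\ i\in[-1,j],$$ $$B_{kji}:=\operatorname{row}W_{k\sim j}\cap\operatorname{null}W_{j\sim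 i-1}^\top=\bigoplus_{t=k}^{L}\bigoplus_{s=i}^{j}b_{tjs},\qquad k\in[j,L+1],\ i\in[0,j+1].$$ The dimensions of $A_{kji}$ and $B_{kji}$ are, respectively, $\alpha_{kji}=\sum_{t=j}^{k}\sum_{s=0}^{i}\omega_{ts}$ and $\beta_{kji}=\sum_{t=k}^{L}\sum_{s=i}^{j}\omega_{ts}$. Moreover $d_j=\sum_{t=j}^{L}\sum_{s=0}^{j}\omega_{ts}$ and $\operatorname{rk}W_{k\sim i}=\sum_{t=k}^{L}\sum_{s=0}^{i}\omega_{ts}$. (The decomposition is not necessarily unique, but the dimensions $\omega_{ki},\alpha_{kji},\beta_{kji}$ are the same for all such decompositions.) Moreover, given direct sum decompositions $\mathcal{A}_j$ ($j\in[0,L]$) satisfying the conditions above, one obtains direct sum decompositions $\mathcal{B}_j$ satisfying the conditions above by choosing $$b_{kji}=\Bigl(\sum_{(k',i')\ne(k,i)}a_{k'ji'}\Bigr)^{\perp},$$ where the sum is over $k'\in[j,L]$, $i'\in[0,j]$. Symmetrically, given $\mathcal{B}_j$ satisfying the conditions above, one obtains $\mathcal{A}_j$ satisfying them by choosing $a_{kji}=\bigl(\sum_{(k',i')\ne(k,i)}b_{k'ji'}\bigr)^{\perp}$.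
   Context: Fix integers $L\ge1$ and $d_0,\ldots,d_L\ge1$. For $L\ge k\ge i\ge0$, the subsequence matrix is $W_{k\sim i}=W_kW_{k-1}\cdots W_{i+1}\in\mathbb{R}^{d_k\times d_i}$, with $W_{k\sim k}=I_{d_k\times d_k}$. Conventions: $W_{j\sim-1}=0_{d_j\times1}$ and $W_{L+1\sim j}=0_{1\times d_j}$ (zero matrices, rank $0$). For integers $p,q$, $[p,q]$ denotes $\{p,p+1,\ldots,q\}$. For a matrix $M$ and a subspace $Z$, $MZ=\{Mv:v\in Z\}$. $\operatorname{null}$, $\operatorname{col}$, $\operatorname{row}$, $\operatorname{rk}$ denote nullspace, columnspace, rowspace and rank. A set $\{X_1,\dots,X_m\}$ of subspaces is a direct sum decomposition of a vector space $V$ if $V=X_1\oplus\cdots\oplus X_m$ (the sum is $V$ and $X_i\cap\sum_{j\neq i}X_j=\{\mathbf 0\}$ for all $i$). An empty direct sum is $\{\mathbf 0\}$. $Z^\perp$ is the orthogonal complement in the relevant $\mathbb{R}^{d_j}$. *)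

(* Defs.v *)
(* MathComp; the field of real numbers is an arbitrary realType. Vectors of
   R^n are column vectors. *)
From HB Require Import structures.
From mathcomp Require Import all_boot all_order all_algebra.
From mathcomp Require Import sesquilinear reals.

Set Implicit Arguments.
Unset Strict Implicit.
Unset Printing Implicit Defensive.

Import Order.TTheory GRing.Theory Num.Theory.
Local Open Scope ring_scope.

Section Subspaces.
Variable R : realType.

Definition imgsp m n (M : 'M[R]_(m, n)) (Z : {vspace 'cV[R]_n}) :
    {vspace 'cV[R]_m} := (linfun (mulmx M) @: Z)%VS.

Definition nullsp m n (M : 'M[R]_(m, n)) : {vspace 'cV[R]_n} :=
  lker (linfun (mulmx M)).

Definition colsp m n (M : 'M[R]_(m, n)) : {vspace 'cV[R]_m} := imgsp M fullv.

Definition rowsp m n (M : 'M[R]_(m, n)) : {vspace 'cV[R]_n} := colsp M^T.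

Definition dotv n (u v : 'cV[R]_n) : R := \sum_i u i 0 * v i 0.

Lemma dotv_is_bilinear n :
  bilinear_for (GRing.Scale.Law.clone _ _ *%R _)
    (GRing.Scale.Law.clone _ _ (idfun \; *%R) _) (@dotv n : _ -> _ -> R).
Proof.
split=> [w a u v|w a u v]; rewrite /dotv /= mulr_sumr -big_split /=;
  apply: eq_bigr => i _; rewrite !mxE; first by rewrite mulrDl mulrA.
by rewrite mulrDr mulrCA.
Qed.

HB.instance Definition _ n :=
  bilinear_isBilinear.Build R _ _ _ _ _ (@dotv n) (@dotv_is_bilinear n).

Lemma dotv_is_symmetric n (u v : 'cV[R]_n) :
  dotv u v = (-1) ^+ false * idfun (dotv v u).
Proof. by rewrite mul1r; apply: eq_bigr => i _; rewrite mulrC. Qed.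

HB.instance Definition _ n :=
  isHermitianSesquilinear.Build R _ _ _ (@dotv n) (@dotv_is_symmetric n).

Definition perpsp n (Z : {vspace 'cV[R]_n}) : {vspace 'cV[R]_n} :=
  orthov (@dotv n) Z.

Lemma perpspP n (Z : {vspace 'cV[R]_n}) (u : 'cV[R]_n) :
  reflect {in Z, forall v, dotv u v = 0} (u \in perpsp Z).
Proof. exact: mem_orthovP. Qed.

(* [directv] is the library's directness of a sum expression; [directv_sumP]
   says that each X_p meets the sum of the others trivially. *)
Definition direct_sum_of n (I : finType) (U : {vspace 'cV[R]_n}) (P : pred I)
    (X : I -> {vspace 'cV[R]_n}) : Prop :=
  (\sum_(p | P p) X p)%VS = U /\ directv (\sum_(p | P p) X p).

End Subspaces.

Section LinearNetwork.
(* L is the number of layers.  The matrix [W j] has size d_{j+1} x d_j: it is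
   the weight matrix written W_{j+1} in the 1-based convention.  Only the sizes
   d_0, ..., d_L and the matrices W 0, ..., W L.-1 are meaningful. *)
Variables (R : realType) (L : nat) (d : nat -> nat).
Variable W : forall j, 'M[R]_(d j.+1, d j).

(* For i <= k this is W_k W_{k-1} ... W_{i+1}; it is 0 for k < i. The first
   branch is the identity matrix, written [pid_mx] because k and i are only
   propositionally equal there. *)
Fixpoint prodmx (k i : nat) : 'M[R]_(d k, d i) :=
  if k == i then pid_mx (d i) else
  match k return 'M[R]_(d k, d i) with
  | 0 => 0
  | k'.+1 => W k' *m prodmx k' i
  end.

Lemma prodmx_diag k : prodmx k k = 1%:M.
Proof. by case: k => [|k] /=; rewrite ?eqxx pid_mx_1. Qed.

Lemma prodmxS k i : (i <= k)%N -> prodmx k.+1 i = W k *m prodmx k i.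
Proof. by move=> ik /=; rewrite gtn_eqF. Qed.

Definition dimZ (j : int) : nat := if j is Posz n then d n else 1.

(* W_{k~i} with the conventions W_{k~-1} = 0 and W_{L+1~i} = 0. The number of
   rows of W_{L+1~i} is d (L+1), an arbitrary number: the rank, nullspace and
   rowspace of a zero matrix do not depend on its number of rows. *)
Definition subseqmx (k i : int) : 'M[R]_(dimZ k, dimZ i) :=
  match k, i return 'M[R]_(dimZ k, dimZ i) with
  | Posz k', Posz i' => if (k' <= L)%N then prodmx k' i' else 0
  | _, _ => 0
  end.

Definition omega (k i : int) : int :=
  (\rank (subseqmx k i))%:Z - (\rank (subseqmx k (i - 1)))%:Z
  - (\rank (subseqmx (k + 1) i))%:Z + (\rank (subseqmx (k + 1) (i - 1)))%:Z.

Definition Asp (k : int) (j : nat) (i : int) : {vspace 'cV[R]_(d j)} :=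
  (nullsp (subseqmx (k + 1) j) :&: colsp (subseqmx j i))%VS.

Definition Bsp (k : int) (j : nat) (i : int) : {vspace 'cV[R]_(d j)} :=
  (rowsp (subseqmx k j) :&: nullsp (subseqmx j (i - 1))^T)%VS.

(* A family (a_{kji}), with arguments in the order k, j, i; its values outside
   the range L >= k >= j >= i >= 0 are irrelevant. *)
Definition spfamily : Type :=
  forall k j i : nat, {vspace 'cV[R]_(d j)}.

(* The pair p stands for (k, i), with 0 <= k, i <= L. *)
Definition in_layer (j : nat) (p : 'I_L.+1 * 'I_L.+1) : bool :=
  (j <= p.1)%N && (p.2 <= j)%N.

Definition has_dims (a : spfamily) : Prop :=
  forall k j i : nat, (i <= j)%N -> (j <= k)%N -> (k <= L)%N ->
    (\dim (a k j i))%:Z = omega k i.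

(* The nonzero members are taken as an indexed family, so that directness also
   excludes repetitions; the sum is over the pairs p = (k, i). *)
Definition decomposes_layers (a : spfamily) : Prop :=
  forall j : nat, (j <= L)%N ->
    direct_sum_of fullv
      (fun p => in_layer j p && (a p.1 j p.2 != 0%VS))
      (fun p => a p.1 j p.2).

(* [W j] is W_{j+1}: the layer index j of the usual statement is j.+1 here. *)
Definition flows_forward (a : spfamily) : Prop :=
  forall k j i : nat, (j < L)%N -> (j <= k)%N -> (k <= L)%N -> (i <= j)%N ->
    imgsp (W j) (a k j i) = if (j.+1 <= k)%N then a k j.+1 i else 0%VS.

Definition flows_backward (b : spfamily) : Prop :=
  forall k j i : nat, (j < L)%N -> (j.+1 <= k)%N -> (k <= L)%N ->
      (i <= j.+1)%N ->
    imgsp (W j)^T (b k j.+1 i) = if (i < j.+1)%N then b k j i else 0%VS.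

Definition A_decomposition (a : spfamily) : Prop :=
  [/\ has_dims a, decomposes_layers a & flows_forward a].

Definition B_decomposition (b : spfamily) : Prop :=
  [/\ has_dims b, decomposes_layers b & flows_backward b].

Definition dual_family (a : spfamily) : spfamily := fun k j i =>
  perpsp (\sum_(p | in_layer j p &&
                     ((p.1 : nat, p.2 : nat) != (k, i))) a p.1 j p.2)%VS.

End LinearNetwork.

(* Main.v *)
(* For one matrix M, suppose direct decompositions of its domain and codomain
   are indexed so that M sends each X_p either onto a Y_p of the same dimension
   or to 0. Then col M and null M are partial sums of these decompositions, and
   M^T acts in the same way on the dual decompositions
   (sum_{q <> p} X_q)^perp. Applied to the subsequence matrices and their
   transposes this gives A_{kji} and B_{kji} as intersections of partial sums
   of one direct sum, and applied to W_j it exchanges the A- and B-conditions.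
   The rank and dimension formulas are a telescoping of the definition of
   omega. For existence, choose at each layer i a complement of
   (col W_{i~i-1} cap null W_{k+1~i}) + null W_{k~i} in null W_{k+1~i} and
   push it forward. Its dimension is omega_{ki}; by induction on j these images
   span R^{d_j}, and as the omegas sum to d_j, no dimension is lost on the way
   and the sum is direct. *)
Require Import Defs.
From HB Require Import structures.
From mathcomp Require Import all_boot all_order all_algebra.
From mathcomp Require Import sesquilinear reals.
From mathcomp Require Import zify.

Set Implicit Arguments.
Unset Strict Implicit.
Unset Printing Implicit Defensive.

Import Order.TTheory GRing.Theory Num.Theory.
Local Open Scope ring_scope.

(** * Partial sums of a direct family of subspaces *)

Section SubFamilies.
Variables (K : fieldType) (vT : vectType K) (I : finType).
Implicit Types (P Q : pred I) (X : I -> {vspace vT}).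

(** A choice of vectors indexed by [P] becomes one indexed by [Q] when it is extended by 0. *)
Lemma directv_sub P Q X : {subset P <= Q} ->
  directv (\sum_(p | Q p) X p) -> directv (\sum_(p | P p) X p).
Proof.
move=> PQ /directv_sum_independent dQ; apply/directv_sum_independent.
move=> u uX u0 p Pp; have Qp : Q p by apply: PQ.
suff: (if P p then u p else 0) = 0 by rewrite Pp.
apply: (dQ (fun p => if P p then u p else 0)) => // [q _|].
  by case: ifP => [/uX//|_]; rewrite mem0v.
rewrite -big_mkcondr /= -[RHS]u0; apply: eq_bigl => q.
by apply/andP/idP => [[]|Pq] //; split=> //; apply: PQ.
Qed.

Lemma dim_directv P X : directv (\sum_(p | P p) X p) ->
  \dim (\sum_(p | P p) X p) = (\sum_(p | P p) \dim (X p))%N.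
Proof. by rewrite directvE /= => /eqP. Qed.

Lemma sumv_sub P Q X : {subset P <= Q} ->
  (\sum_(p | P p) X p <= \sum_(p | Q p) X p)%VS.
Proof. by move=> PQ; apply/subv_sumP => p /PQ Qp; apply: (sumv_sup p). Qed.

Lemma sumvU P Q X : (\sum_(p | P p) X p + \sum_(p | Q p) X p =
  \sum_(p | P p || Q p) X p)%VS.
Proof.
apply: subv_anti; apply/andP; split.
  rewrite subv_add !sumv_sub // => p; rewrite !unfold_in => -> //.
  by rewrite orbT.
apply/subv_sumP => p /orP[] Pp.
  by apply: subv_trans (addvSl _ _); apply: (sumv_sup p).
by apply: subv_trans (addvSr _ _); apply: (sumv_sup p).
Qed.

Lemma sumv_nz P X :
  (\sum_(p | P p && (X p != 0)) X p = \sum_(p | P p) X p)%VS.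
Proof.
rewrite [RHS](bigID (fun p => X p != 0%VS)) /= [X in (_ + X)%VS]big1 ?addv0 //.
by move=> p /andP[_ /negPn/eqP].
Qed.

Lemma directv_nz P X :
  directv (\sum_(p | P p && (X p != 0)%VS) X p) = directv (\sum_(p | P p) X p).
Proof.
rewrite !directvE /= sumv_nz; congr (_ == _).
rewrite [RHS](bigID (fun p => X p != 0%VS)) /= [X in (_ + X)%N]big1 ?addn0 //.
by move=> p /andP[_ /negPn/eqP->]; rewrite dimv0.
Qed.

(** One inclusion is clear. Equality follows by counting dimensions: all the partial sums are
    direct, so inclusion-exclusion for index sets matches the dimension formula for a sum and an
    intersection. *)
Lemma sumv_cap P Q U X : {subset P <= U} -> {subset Q <= U} ->
  directv (\sum_(p | U p) X p) ->
  (\sum_(p | P p) X p :&: \sum_(p | Q p) X p = \sum_(p | P p && Q p) X p)%VS.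
Proof.
move=> PU QU dU; apply/esym/eqP; rewrite eqEdim; apply/andP; split.
  rewrite subv_cap !sumv_sub // => p; rewrite !unfold_in; by case/andP.
have PIU : {subset (fun p => P p && Q p) <= U}.
  by move=> p; rewrite unfold_in => /andP[/PU].
have PUU : {subset (fun p => P p || Q p) <= U}.
  by move=> p; rewrite unfold_in => /orP[/PU|/QU].
have := dimv_sum_cap (\sum_(p | P p) X p) (\sum_(p | Q p) X p).
rewrite sumvU !dim_directv; try exact: directv_sub dU.
suff -> : (\sum_(p | P p) \dim (X p) + \sum_(p | Q p) \dim (X p) =
  \sum_(p | P p || Q p) \dim (X p) + \sum_(p | P p && Q p) \dim (X p))%N.
  by move/addnI->.
rewrite !(big_mkcond _ (fun p => \dim (X p))) -!big_split /=.
by apply: eq_bigr => p _; case: (P p); case: (Q p); rewrite ?addn0.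
Qed.

End SubFamilies.

(** * Images, nullspaces and orthogonal complements for matrices *)

Section Matrices.
Variable R : realType.

Lemma mem_imgsp m n (M : 'M[R]_(m, n)) v (Z : {vspace 'cV[R]_n}) :
  v \in Z -> M *m v \in imgsp M Z.
Proof. by move=> vZ; rewrite -[M *m v](lfunE (mulmx M)) memv_img. Qed.

Lemma mem_imgspP m n (M : 'M[R]_(m, n)) v (Z : {vspace 'cV[R]_n}) :
  reflect (exists2 u, u \in Z & v = M *m u) (v \in imgsp M Z).
Proof.
apply: (iffP memv_imgP) => -[u uZ ->]; exists u; rewrite ?lfunE //.
Qed.

Lemma mem_nullsp m n (M : 'M[R]_(m, n)) v : (v \in nullsp M) = (M *m v == 0).
Proof. by rewrite memv_ker lfunE. Qed.

Lemma imgspM m n p (M : 'M[R]_(m, n)) (N : 'M[R]_(n, p)) Z :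
  imgsp (M *m N) Z = imgsp M (imgsp N Z).
Proof.
rewrite /imgsp -limg_comp; congr (_ @: _)%VS; apply/lfunP => u.
by rewrite comp_lfunE !lfunE /= mulmxA.
Qed.

Lemma imgsp1 n Z : imgsp (1%:M : 'M[R]_n) Z = Z.
Proof.
rewrite -[RHS]lim1g /imgsp; congr (_ @: _)%VS; apply/lfunP => u.
by rewrite id_lfunE lfunE /= mul1mx.
Qed.

Lemma imgsp0 m n Z : imgsp (0 : 'M[R]_(m, n)) Z = 0%VS.
Proof.
apply/eqP; rewrite -subv0; apply/subvP => v /mem_imgspP[u _ ->].
by rewrite mul0mx mem0v.
Qed.

Lemma nullsp0 m n : nullsp (0 : 'M[R]_(m, n)) = fullv.
Proof. by apply/vspaceP => v; rewrite mem_nullsp mul0mx eqxx memvf. Qed.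

Lemma nullsp1 n : nullsp (1%:M : 'M[R]_n) = 0%VS.
Proof. by apply/vspaceP => v; rewrite mem_nullsp mul1mx memv0. Qed.

Lemma dim_cV n : \dim {: 'cV[R]_n} = n.
Proof. by rewrite dimvf /dim /= muln1. Qed.

Lemma nullsp_imgsp_dim m n (M : 'M[R]_(m, n)) Z :
  (\dim (Z :&: nullsp M) + \dim (imgsp M Z))%N = \dim Z.
Proof. exact: limg_ker_dim. Qed.

(** In the rank factorization, [row_base M] is onto and [col_base M] is injective, so the
    columnspace is a copy of the middle space. *)
Lemma dim_colsp m n (M : 'M[R]_(m, n)) : \dim (colsp M) = \rank M.
Proof.
rewrite -[in LHS](mulmx_base M) /colsp imgspM.
have -> : imgsp (row_base M) fullv = fullv.
  apply/eqP; rewrite eqEsubv subvf /=; apply/subvP => v _.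
  apply/mem_imgspP; exists (pinvmx (row_base M) *m v); first exact: memvf.
  by rewrite mulmxA mulmxVp ?row_base_free // mul1mx.
have := nullsp_imgsp_dim (col_base M) fullv; rewrite capfv dim_cV.
suff -> : nullsp (col_base M) = 0%VS by rewrite dimv0 add0n.
apply/vspaceP => v; rewrite mem_nullsp memv0.
apply/eqP/eqP => [|->]; last first.
  by rewrite mulmx0.
move/(congr1 (mulmx (pinvmx (col_base M)))).
by rewrite mulmxA mulVpmx ?col_base_full // mul1mx mulmx0.
Qed.

Lemma dim_nullsp m n (M : 'M[R]_(m, n)) : (\dim (nullsp M) + \rank M)%N = n.
Proof. by rewrite -dim_colsp -[nullsp M]capfv nullsp_imgsp_dim dim_cV. Qed.

Lemma dotvC n (u v : 'cV[R]_n) : dotv u v = dotv v u.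
Proof. by apply: eq_bigr => i _; rewrite mulrC. Qed.

Lemma dotvv_eq0 n (u : 'cV[R]_n) : (dotv u u == 0) = (u == 0).
Proof.
rewrite /dotv psumr_eq0 => [|i _]; last by rewrite -expr2 sqr_ge0.
apply/allP/eqP => [u0|-> i _]; last by rewrite mxE mul0r eqxx.
apply/colP => i; apply/eqP; rewrite mxE -sqrf_eq0 expr2.
by apply: u0; rewrite mem_index_enum.
Qed.

Lemma dotv_mulmx m n (M : 'M[R]_(m, n)) u v :
  dotv (M *m u) v = dotv u (M^T *m v).
Proof.
have dotE p (x y : 'cV[R]_p) : dotv x y = (x^T *m y) 0 0.
  by rewrite mxE; apply: eq_bigr => i _; rewrite mxE.
by rewrite !dotE trmx_mul mulmxA.
Qed.

Lemma cap_perpsp n (X : {vspace 'cV[R]_n}) : (X :&: perpsp X = 0)%VS.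
Proof.
apply/eqP; rewrite -subv0; apply/subvP => v.
rewrite memv_cap => /andP[vX /perpspP/(_ v vX)/eqP].
by rewrite dotvv_eq0 memv0.
Qed.

Lemma perpspf n : perpsp (fullv : {vspace 'cV[R]_n}) = 0%VS.
Proof. by rewrite -[LHS]capfv cap_perpsp. Qed.

(** Such a [Z] is orthogonal to the whole space, in particular to itself. *)
Lemma subv_perpsp0 n (Z X Y : {vspace 'cV[R]_n}) : (X + Y = fullv)%VS ->
  (Z <= perpsp X)%VS -> (Z <= perpsp Y)%VS -> Z = 0%VS.
Proof.
move=> XY ZX ZY; apply/eqP; rewrite -subv0 -perpspf -XY.
by rewrite /perpsp orthovD; apply/andP.
Qed.

(** Upper bound: [X] meets its complement trivially. Lower bound: the complement contains the
    nullspace of a matrix whose rows are a basis of [X], and this matrix has rank at most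
    [\dim X]. *)
Lemma dim_perpsp n (X : {vspace 'cV[R]_n}) :
  (\dim (perpsp X) + \dim X)%N = n.
Proof.
apply/eqP; rewrite eqn_leq; apply/andP; split.
  rewrite -[X in (_ <= X)%N]dim_cV addnC -dimv_disjoint_sum ?cap_perpsp //.
  exact: dimvS (subvf _).
pose B : 'M[R]_(\dim X, n) := \matrix_(i, j) (vbasis X)`_i j 0.
suff BX : (nullsp B <= perpsp X)%VS.
  rewrite -[X in (X <= _)%N](dim_nullsp B) leq_add ?dimvS ?rank_leq_row //.
apply/subvP => v; rewrite mem_nullsp => /eqP Bv.
apply/perpspP => u /coord_vbasis->; rewrite linear_sumr big1 // => i _.
rewrite linearZr /= -[X in _ * X](_ : 0 = _) ?mulr0 //.
rewrite dotvC; move/colP/(_ i): Bv; rewrite !mxE => <-.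
by apply: eq_bigr => j _; rewrite !mxE.
Qed.

Lemma imgsp_perpsp m n (M : 'M[R]_(m, n)) X Y : (imgsp M X <= Y)%VS ->
  (imgsp M^T (perpsp Y) <= perpsp X)%VS.
Proof.
move=> MXY; apply/subvP => _ /mem_imgspP[v /perpspP vY ->].
apply/perpspP => u uX; rewrite dotv_mulmx trmxK.
by apply: vY; apply: (subvP MXY); apply: mem_imgsp.
Qed.

Lemma nullsp_tr m n (M : 'M[R]_(m, n)) : (nullsp M^T <= perpsp (colsp M))%VS.
Proof.
apply/subvP => v; rewrite mem_nullsp => /eqP Mv.
apply/perpspP => _ /mem_imgspP[u _ ->].
by rewrite dotvC dotv_mulmx Mv; apply: big1 => i _; rewrite mxE mulr0.
Qed.

End Matrices.

(** * The dual of a direct sum decomposition *)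

Section DualDecomposition.
Variables (R : realType) (n : nat) (I : finType) (P : pred I).
Variable X : I -> {vspace 'cV[R]_n}.
Hypothesis dX : direct_sum_of fullv P X.

Let Y p := perpsp (\sum_(q | P q && (q != p)) X q)%VS.

Lemma dual_summand_dim p : P p -> \dim (Y p) = \dim (X p).
Proof.
move=> Pp; have [sX /dim_directv] := dX.
rewrite sX dim_cV (bigD1 p) //=.
rewrite -(@dim_directv _ _ _ (fun q => P q && (q != p))).
  move=> nE; apply: (@addIn (\dim (\sum_(q | P q && (q != p)) X q))).
  by rewrite dim_perpsp -nE.
by apply: directv_sub dX.2 => q; rewrite unfold_in => /andP[].
Qed.

(** A vector of [Y p] is orthogonal to all [X q] with [q] other than [p]; a sum of vectors from the
    other [Y q] is orthogonal to [X p]. A common vector is therefore 0, and the dimensions add up to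
    [n]. *)
Lemma dual_direct_sum : direct_sum_of fullv P Y.
Proof.
have dY : directv (\sum_(p | P p) Y p).
  apply/directv_sumP => p Pp.
  apply: (subv_perpsp0 (X := X p) (Y := (\sum_(q | P q && (q != p)) X q)%VS)).
  - by rewrite -dX.1 [RHS](bigD1 p).
  - apply: subv_trans (capvSr _ _) _; apply/subv_sumP => q /andP[Pq qp].
    apply/orthovP => u v /perpspP uX vX; apply: uX.
    by apply: subvP vX; apply: (sumv_sup p); rewrite // Pp eq_sym.
  - exact: capvSl.
split=> //; apply/eqP; rewrite eqEdim subvf dim_directv // -dX.1.
by rewrite dim_directv ?dX.2 // leq_sum // => p Pp; rewrite dual_summand_dim.
Qed.

End DualDecomposition.

(** * A matrix that sends each summand onto a summand or to zero *)

Section CompatibleDecompositions.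
Variables (R : realType) (m n : nat) (M : 'M[R]_(m, n)).
Variables (I : finType) (P Q : pred I).
Variables (X : I -> {vspace 'cV[R]_n}) (Y : I -> {vspace 'cV[R]_m}).
Hypotheses (dX : direct_sum_of fullv P X) (dY : direct_sum_of fullv Q Y).
Hypothesis dimXY : forall p, P p -> Q p -> \dim (X p) = \dim (Y p).
Hypothesis MX : forall p, P p -> imgsp M (X p) = if Q p then Y p else 0%VS.

Lemma colsp_compatible : colsp M = (\sum_(p | P p && Q p) Y p)%VS.
Proof.
rewrite /colsp -dX.1 /imgsp limg_sum [RHS]big_mkcondr.
by apply: eq_bigr => p /MX.
Qed.

(** The summands sent to 0 lie in the nullspace; by rank-nullity they already have its dimension,
    since the others keep theirs. *)
Lemma nullsp_compatible : nullsp M = (\sum_(p | P p && ~~ Q p) X p)%VS.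
Proof.
apply/esym/eqP; rewrite eqEdim; apply/andP; split.
  apply/subv_sumP => p /andP[Pp /negbTE nQ]; have := MX Pp; rewrite nQ => MXp.
  by apply/subvP => v vX; rewrite mem_nullsp -memv0 -MXp mem_imgsp.
rewrite -(leq_add2r (\rank M)) dim_nullsp -dim_colsp colsp_compatible.
rewrite !dim_directv.
- rewrite -[leqLHS](dim_cV R n) -dX.1 (dim_directv dX.2) (bigID Q) /=.
  rewrite addnC leq_add2l leq_eqVlt; apply/orP/or_introl/eqP.
  by apply: eq_bigr => p /andP[]; apply: dimXY.
- by apply: directv_sub dY.2 => p /andP[].
- by apply: directv_sub dX.2 => p /andP[].
Qed.

(** As [M^T] is the adjoint of [M], an inclusion of an image under [M] reverses on orthogonal
    complements. Equality holds because [M^T] is injective on the dual summand. *)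
Lemma dual_compatible p : Q p ->
  imgsp M^T (perpsp (\sum_(q | Q q && (q != p)) Y q)) =
  if P p then perpsp (\sum_(q | P q && (q != p)) X q)%VS else 0%VS.
Proof.
move=> Qp.
(* Only [X p] can reach [Y p]. This is used with all of [P] when [p] is outside [P], and with [P]
   minus [p] otherwise. *)
have sub (P' : pred I) : {subset P' <= P} -> ~~ P' p ->
    (imgsp M (\sum_(q | P' q) X q) <= \sum_(q | Q q && (q != p)) Y q)%VS.
  move=> sP' nP'p; rewrite /imgsp limg_sum; apply/subv_sumP => q P'q.
  rewrite -/(imgsp _ _) (MX (sP' q P'q)); case: ifP => Qq; rewrite ?sub0v //.
  by apply: (sumv_sup q); rewrite ?Qq //; apply: contraNneq nP'p => <-.
case: ifP => Pp; last first.
  apply/eqP; rewrite -subv0 -(perpspf R n) imgsp_perpsp // -dX.1.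
  by apply: sub; rewrite ?Pp.
apply/eqP; rewrite eqEdim; apply/andP; split.
  by apply/imgsp_perpsp/sub => [q /andP[]|]; rewrite ?eqxx ?andbF.
rewrite (dual_summand_dim dX) // dimXY // -(dual_summand_dim dY Qp).
rewrite -[leqLHS](nullsp_imgsp_dim M^T).
rewrite [X in \dim X](_ : _ = 0%VS) ?dimv0 //.
(* A vector killed by [M^T] is orthogonal to the columnspace, which contains [Y p]. *)
apply: (subv_perpsp0 (X := Y p) (Y := (\sum_(q | Q q && (q != p)) Y q)%VS)).
- by rewrite -dY.1 [RHS](bigD1 p).
- apply: subv_trans (capvSr _ _) _; apply: subv_trans (nullsp_tr M) _.
  apply/orthovP => u v /perpspP uP vY; apply: uP; rewrite colsp_compatible.
  apply: subvP vY; apply: (sumv_sup p); rewrite ?Pp ?Qp //.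
- exact: capvSl.
Qed.

End CompatibleDecompositions.

Lemma eq_direct_sum (R : realType) n (I : finType) U (P : pred I)
    (X Y : I -> {vspace 'cV[R]_n}) : (forall p, P p -> X p = Y p) ->
  direct_sum_of U P X -> direct_sum_of U P Y.
Proof.
move=> XY [<-]; rewrite /direct_sum_of !directvE /= (eq_bigr _ XY) => /eqP dX.
by split=> //; rewrite dX; apply/eqP/eq_bigr => p /XY->.
Qed.

(** Unpacks the pair of ordinals so that their bounds are available to [lia]. *)
Ltac layer_lia :=
  case=> [[t tL] [s sL]]; rewrite ?unfold_in /in_layer /=;
  try apply/idP/idP; lia.

(** * Subsequence matrices and sums of the omegas *)

Section Network.
Variables (R : realType) (L : nat) (d : nat -> nat).
Variable W : forall j, 'M[R]_(d j.+1, d j).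

Local Notation omega := (omega L W).
Local Notation S := (subseqmx L W).
Local Notation layer := (@in_layer L).

Lemma subseqmxE (k i : nat) : (k <= L)%N -> S k i = prodmx W k i.
Proof. by move=> kL; rewrite /= kL. Qed.

Lemma subseqmx_over (k : nat) (i : int) : (L < k)%N -> S k i = 0.
Proof. by case: i => i // Lk; rewrite /= leqNgt Lk. Qed.

Lemma prodmxSr k i : (i < k)%N -> prodmx W k i = prodmx W k i.+1 *m W i.
Proof.
elim: k => // k IH; rewrite ltnS leq_eqVlt => /predU1P[->|ik].
  by rewrite prodmxS // !prodmx_diag mul1mx mulmx1.
by rewrite [in RHS]prodmxS // prodmxS ?(ltnW ik) // IH // mulmxA.
Qed.

Lemma predSz n : n.+1%:Z - 1 = n.
Proof. lia. Qed.

Lemma succZ n : n%:Z + 1 = n.+1.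
Proof. lia. Qed.

(** For [k] beyond [L], and for [i = 0], both sides vanish by convention. *)
Lemma subseqmx_pred (k i : nat) : (i <= k)%N ->
  S k i *m S i (i%:Z - 1) = S k (i%:Z - 1).
Proof.
move=> ik; case: (ltnP L k) => [Lk|kL].
  by rewrite !(subseqmx_over _ Lk) mul0mx.
case: i ik => [|i] ik; first by rewrite mulmx0.
rewrite predSz !subseqmxE ?(leq_trans ik) // (prodmxSr ik).
by rewrite prodmxS // prodmx_diag mulmx1.
Qed.

(** Telescoping in [s]; the lower boundary term, at index -1, consists of ranks of zero matrices. *)
Lemma sum_omega_col (t n : nat) : \sum_(0 <= s < n) omega t s =
  (\rank (S t (n%:Z - 1)))%:Z - (\rank (S t.+1 (n%:Z - 1)))%:Z.
Proof.
elim: n => [|n IH]; first by rewrite big_geq // !mxrank0.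
rewrite predSz big_nat_recr // IH /Defs.omega succZ -[LHS]/(_ + _); lia.
Qed.

(** Second telescoping, now in [t]; the upper boundary term is the rank of W_{L+1~i}, which is 0. *)
Lemma sum_omega (k i : nat) : (k <= L.+1)%N ->
  \sum_(k <= t < L.+1) \sum_(0 <= s < i.+1) omega t s = (\rank (S k i))%:Z.
Proof.
move=> kL; under eq_bigr do rewrite sum_omega_col predSz -opprB.
rewrite sumrN (telescope_sumr (fun t : nat => (\rank (S t i))%:Z)) //.
by rewrite opprB [S L.+1 _]subseqmx_over // mxrank0 subr0.
Qed.

Lemma sum_omega_layer j : (j <= L)%N ->
  \sum_(j <= t < L.+1) \sum_(0 <= s < j.+1) omega t s = (d j)%:Z.
Proof.
by move=> jL; rewrite sum_omega ?leqW // subseqmxE // prodmx_diag mxrank1.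
Qed.

Lemma index_pair k i : (k <= L)%N -> (i <= L)%N ->
  exists p : 'I_L.+1 * 'I_L.+1, k = p.1 :> nat /\ i = p.2 :> nat.
Proof.
move=> kL iL; exists (inord k, inord i); by rewrite !inordK.
Qed.

(** * Families layer by layer, their transport along products, and their duals *)

Definition summand (a : spfamily R d) j (p : 'I_L.+1 * 'I_L.+1) := a p.1 j p.2.

Lemma decomposes_direct a j : decomposes_layers L a -> (j <= L)%N ->
  direct_sum_of fullv (layer j) (summand a j).
Proof.
move=> da /da[sa]; rewrite directv_nz => dira; split=> //.
by rewrite -sa sumv_nz.
Qed.

Lemma direct_decomposes a :
  (forall j, (j <= L)%N -> direct_sum_of fullv (layer j) (summand a j)) ->
  decomposes_layers L a.
Proof. by move=> da j /da[sa dira]; split; rewrite ?sumv_nz ?directv_nz. Qed.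

Lemma dim_summand a j p : has_dims L W a -> layer j p ->
  (\dim (summand a j p))%:Z = omega p.1 p.2.
Proof. by move=> ha /andP[jp pj]; rewrite ha // -ltnS ltn_ord. Qed.

Lemma dim_summandE a b j k p : has_dims L W a -> has_dims L W b ->
  layer j p -> layer k p -> \dim (summand a j p) = \dim (summand b k p).
Proof.
by move=> ha hb jp kp; apply/eqP; rewrite -eqz_nat !dim_summand.
Qed.

(** Induction on [k]: a space with first index [t] survives up to layer [t], and its image is 0 from
    then on. *)
Lemma forward_prodmx a t k j i : flows_forward L W a ->
  (i <= j)%N -> (j <= k)%N -> (j <= t)%N -> (t <= L)%N -> (k <= L)%N ->
  imgsp (prodmx W k j) (a t j i) = if (k <= t)%N then a t k i else 0%VS.
Proof.
move=> fa ij jk jt tL; elim: k jk => [|k IH].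
  by rewrite leqn0 => /eqP j0; subst j; rewrite prodmx_diag imgsp1.
rewrite leq_eqVlt => /predU1P[jk|jk] kL.
  by move: jt; rewrite jk in ij *; rewrite prodmx_diag imgsp1 => ->.
rewrite prodmxS // imgspM IH ?(ltnW kL) //; case: (leqP k t) => kt.
  by rewrite fa // (leq_trans ij).
by rewrite ltnNge ltnW // /imgsp limg0.
Qed.

Lemma backward_prodmx b t k j i : flows_backward L W b ->
  (i <= k)%N -> (j <= k)%N -> (k <= t)%N -> (t <= L)%N ->
  imgsp (prodmx W k j)^T (b t k i) = if (i <= j)%N then b t j i else 0%VS.
Proof.
move=> fb; elim: k => [|k IH].
  by move=> ik; rewrite leqn0 => /eqP->; rewrite prodmx_diag trmx1 imgsp1 ik.
move=> ik; rewrite leq_eqVlt => /predU1P[->|jk] kt tL.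
  by rewrite prodmx_diag trmx1 imgsp1 ik.
rewrite prodmxS // trmx_mul imgspM fb // ?(leq_trans kt) //.
case: ltnP => ik'; first by rewrite IH // ltnW.
by rewrite leqNgt (leq_trans jk ik') /imgsp limg0.
Qed.

(** [dual_family] compares indices as natural numbers, the general duality lemmas as ordinals; both
    exclude the same pair. *)
Lemma dual_summandE a j p : summand (dual_family L a) j p =
  perpsp (\sum_(q | layer j q && (q != p)) summand a j q)%VS.
Proof. by case: p => k i; congr perpsp; apply: eq_bigl => -[t s]. Qed.

Lemma dual_has_dims a : has_dims L W a ->
  (forall j, (j <= L)%N -> direct_sum_of fullv (layer j) (summand a j)) ->
  has_dims L W (dual_family L a).
Proof.
move=> ha da k j i ij jk kL.
have jL := leq_trans jk kL.
have [|p [kp ip]] := index_pair kL (_ : (i <= L)%N); first exact: leq_trans jL.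
have jp : layer j p by rewrite /in_layer -kp -ip jk ij.
by rewrite {}kp {}ip -/(summand _ _ _) dual_summandE
  (dual_summand_dim (da j jL)) // dim_summand.
Qed.

Lemma dual_decomposes a :
  (forall j, (j <= L)%N -> direct_sum_of fullv (layer j) (summand a j)) ->
  decomposes_layers L (dual_family L a).
Proof.
move=> da; apply: direct_decomposes => j /da /dual_direct_sum.
by apply: eq_direct_sum => p _; rewrite dual_summandE.
Qed.

(** * Consequences of the A-conditions *)

Section Forward.
Variable a : spfamily R d.
Hypothesis Aa : A_decomposition L W a.

Let da j jL := @decomposes_direct a j (let: And3 _ h _ := Aa in h) jL.
Let ha : has_dims L W a := let: And3 h _ _ := Aa in h.
Let fa : flows_forward L W a := let: And3 _ _ h := Aa in h.

Lemma forward_compatible j k p : (j <= k)%N -> (k <= L)%N -> layer j p ->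
  imgsp (prodmx W k j) (summand a j p) =
  if layer k p then summand a k p else 0%VS.
Proof.
move=> jk kL /andP[jp pj].
by rewrite forward_prodmx // -1?ltnS // /in_layer (leq_trans pj jk) andbT.
Qed.

(** The summands listed are those that die before layer [k]. For [k] beyond [L] the matrix is 0 and
    every summand qualifies. *)
Lemma nullsp_forward (j k : nat) : (j <= L)%N -> (j <= k)%N ->
  nullsp (S k j) = (\sum_(p | layer j p && (p.1 < k)%N) summand a j p)%VS.
Proof.
move=> jL jk; case: (leqP k L) => kL; last first.
  rewrite subseqmx_over // nullsp0 -(da jL).1; apply: eq_bigl => p.
  by rewrite (leq_trans (ltn_ord _)) // andbT.
rewrite subseqmxE // (nullsp_compatible (da jL) (da kL)).
- apply: eq_bigl => p; apply: andb_id2l => /andP[jp pj].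
  by rewrite /in_layer (leq_trans pj jk) andbT -ltnNge.
- by move=> p; apply: dim_summandE.
- by move=> p; apply: forward_compatible.
Qed.

(** The summands that come from layer [i] are those born there or earlier; at [i = -1] the matrix is
    0 and the sum is empty. *)
Lemma colsp_forward (j : nat) (i : int) : (j <= L)%N -> -1 <= i <= j%:Z ->
  colsp (S j i) =
  (\sum_(p | layer j p && ((p.2 : nat)%:Z <= i)%R) summand a j p)%VS.
Proof.
move=> jL; case: i => [i|i] /andP[i1 ij]; last first.
  by rewrite /colsp imgsp0 big_pred0 // => p; rewrite andbF.
have iL : (i <= L)%N by lia.
rewrite subseqmxE //.
rewrite (colsp_compatible (da iL) (Y := summand a j) (Q := layer j)).
  by apply: eq_bigl; layer_lia.
by move=> p; apply: forward_compatible.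
Qed.

Lemma Asp_forward (j : nat) (k i : int) : (j <= L)%N ->
  j%:Z - 1 <= k <= L%:Z -> -1 <= i <= j%:Z ->
  direct_sum_of (Asp L W k j i)
    (fun p : 'I_L.+1 * 'I_L.+1 =>
       (j%:Z <= (p.1 : nat)%:Z <= k) && (0 <= (p.2 : nat)%:Z <= i))
    (summand a j).
Proof.
move=> jL kb ib.
(* When [j = 0], [k] may be -1, but [k + 1] is always a natural number. *)
have [k' kE] : exists k' : nat, k + 1 = k'%:Z by exists `|(k + 1)%R|%N; lia.
have jk' : (j <= k')%N by lia.
split; last first.
  by apply: directv_sub (da jL).2 ; layer_lia.
rewrite /Asp kE nullsp_forward // colsp_forward //.
rewrite (sumv_cap (U := layer j)) ?(da jL).2 //; last 2 first.
- by move=> p /andP[].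
- by move=> p /andP[].
by apply: eq_bigl; layer_lia.
Qed.

Lemma dual_forward : B_decomposition L W (dual_family L a).
Proof.
split.
- by apply: dual_has_dims => // j; apply: da.
- by apply: dual_decomposes => j; apply: da.
move=> k j i jL jk kL ij.
have [|p [kp ip]] := index_pair kL (_ : (i <= L)%N); first exact: leq_trans jL.
rewrite {}kp {}ip in jk kL ij *; rewrite -!/(summand _ _ _) !dual_summandE.
(* The domain is layer [j] and the codomain layer [j.+1], so the transpose runs backward. *)
rewrite (dual_compatible (da (ltnW jL)) (da jL) _ _ (M := W j)).
- by rewrite /in_layer ltnS (ltnW jk).
- by move=> q; apply: dim_summandE.
- move=> q /andP[jq qj].
  by rewrite fa // -1?ltnS // /in_layer (leq_trans qj) // andbT.
- by rewrite /in_layer jk.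
Qed.

End Forward.

(** * Consequences of the B-conditions *)

Section Backward.
Variable b : spfamily R d.
Hypothesis Bb : B_decomposition L W b.

Let db j jL := @decomposes_direct b j (let: And3 _ h _ := Bb in h) jL.
Let hb : has_dims L W b := let: And3 h _ _ := Bb in h.
Let fb : flows_backward L W b := let: And3 _ _ h := Bb in h.

Lemma backward_compatible j k p : (j <= k)%N -> (k <= L)%N -> layer k p ->
  imgsp (prodmx W k j)^T (summand b k p) =
  if layer j p then summand b j p else 0%VS.
Proof.
move=> jk kL /andP[kp pk].
by rewrite backward_prodmx // -1?ltnS // /in_layer (leq_trans jk kp).
Qed.

(** The transpose carries layer [k] back to layer [j], so the summands hit are those still alive at
    layer [k]. *)
Lemma rowsp_backward (j k : nat) : (j <= L)%N -> (j <= k)%N ->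
  rowsp (S k j) = (\sum_(p | layer j p && (k <= p.1)%N) summand b j p)%VS.
Proof.
move=> jL jk; rewrite /rowsp; case: (leqP k L) => kL; last first.
  rewrite subseqmx_over // trmx0 /colsp imgsp0 big_pred0 //.
  by layer_lia.
rewrite subseqmxE //.
rewrite (colsp_compatible (db kL) (Y := summand b j) (Q := layer j)).
  by apply: eq_bigl; layer_lia.
by move=> p; apply: backward_compatible.
Qed.

Lemma nullsp_backward (j : nat) (i : int) : (j <= L)%N -> -1 <= i <= j%:Z ->
  nullsp (S j i)^T =
  (\sum_(p | layer j p && (i < (p.2 : nat)%:Z)%R) summand b j p)%VS.
Proof.
move=> jL; case: i => [i|i] /andP[i1 ij]; last first.
  rewrite [S _ _]/(0) trmx0 nullsp0 -(db jL).1; apply: eq_bigl.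
  by layer_lia.
have iL : (i <= L)%N by lia.
rewrite subseqmxE // (nullsp_compatible (db jL) (db iL)).
- by apply: eq_bigl; layer_lia.
- by move=> p; apply: dim_summandE.
- by move=> p; apply: backward_compatible.
Qed.

Lemma Bsp_backward (j : nat) (k i : int) : (j <= L)%N ->
  j%:Z <= k <= L%:Z + 1 -> 0 <= i <= j%:Z + 1 ->
  direct_sum_of (Bsp L W k j i)
    (fun p : 'I_L.+1 * 'I_L.+1 =>
       (k <= (p.1 : nat)%:Z <= L%:Z) && (i <= (p.2 : nat)%:Z <= j%:Z))
    (summand b j).
Proof.
move=> jL; case: k => // k kb ib.
split; last first.
  by apply: directv_sub (db jL).2; layer_lia.
rewrite /Bsp rowsp_backward ?nullsp_backward //; try lia.
rewrite (sumv_cap (U := layer j)) ?(db jL).2 //; last 2 first.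
- by move=> p /andP[].
- by move=> p /andP[].
by apply: eq_bigl; layer_lia.
Qed.

Lemma dual_backward : A_decomposition L W (dual_family L b).
Proof.
split.
- by apply: dual_has_dims => // j; apply: db.
- by apply: dual_decomposes => j; apply: db.
move=> k j i jL jk kL ij.
have [|p [kp ip]] := index_pair kL (_ : (i <= L)%N).
  exact: leq_trans (ltnW jL).
rewrite {}kp {}ip in jk kL ij *; rewrite -!/(summand _ _ _) !dual_summandE.
(* [W j] is the transpose of [(W j)^T], to which duality applies with layer [j.+1] as its domain. *)
rewrite -[W j]trmxK (dual_compatible (db jL) (db (ltnW jL)) _ _ (M := (W j)^T)).
- by rewrite /in_layer (leqW ij) andbT.
- by move=> q; apply: dim_summandE.
- move=> q /andP[jq qj].
  by rewrite fb // -1?ltnS // /in_layer (ltnW jq).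
- by rewrite /in_layer jk.
Qed.

End Backward.

(** * Existence: newborn spaces and their forward flow *)

(* The vectors of layer i killed by W_{k+1~i} that already come from layer i - 1
   or are killed by W_{k~i}; a complement of these is born at layer i and dies
   right after layer k. *)
Definition old_or_dead k i : {vspace 'cV[R]_(d i)} :=
  (colsp (S i (i%:Z - 1)) :&: nullsp (S k.+1 i) + nullsp (S k i))%VS.

Definition newborn k i : {vspace 'cV[R]_(d i)} :=
  (nullsp (S k.+1 i) :\: old_or_dead k i)%VS.

Definition flow_of_newborns : spfamily R d :=
  fun k j i => imgsp (prodmx W j i) (newborn k i).

Lemma nullspS k i : (i <= k)%N -> (nullsp (S k i) <= nullsp (S k.+1 i))%VS.
Proof.
move=> ik; case: (leqP k.+1 L) => kL; last first.
  by rewrite (subseqmx_over _ kL) nullsp0 subvf.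
rewrite !subseqmxE ?(ltnW kL) // prodmxS //.
by apply/subvP => v; rewrite !mem_nullsp -mulmxA => /eqP->; rewrite mulmx0.
Qed.

Lemma newborn_split k i : (i <= k)%N ->
  (newborn k i + old_or_dead k i = nullsp (S k.+1 i))%VS.
Proof.
move=> ik.
by rewrite addv_diff; apply/addv_idPl; rewrite subv_add capvSr nullspS.
Qed.

Lemma dim_newborn k i : (i <= k)%N -> (\dim (newborn k i))%:Z = omega k i.
Proof.
move=> ik.
set C := colsp (S i (i%:Z - 1)).
(* Rank-nullity for W_{n~i} restricted to [C], whose image is the columnspace of W_{n~i-1}. *)
have capN n : (i <= n)%N ->
    (\dim (C :&: nullsp (S n i)) + \rank (S n (i%:Z - 1)))%N =
    \rank (S i (i%:Z - 1)).
  move=> ni; rewrite -subseqmx_pred // -!dim_colsp /colsp imgspM.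
  exact: nullsp_imgsp_dim.
have dimN n : (\dim (nullsp (S n i)) + \rank (S n i))%N = d i.
  exact: dim_nullsp.
have := dimv_cap_compl (nullsp (S k.+1 i)) (old_or_dead k i).
rewrite -/(newborn k i) (capv_idPr _); last first.
  by rewrite subv_add capvSr nullspS.
have := dimv_sum_cap (C :&: nullsp (S k.+1 i)) (nullsp (S k i)).
rewrite -/(old_or_dead k i) -capvA (capv_idPr (nullspS ik)).
(* Here [x] is the newborn dimension, [o] that of [old_or_dead], [n] and [c] those of the nullspace
   and of its part in [C], [r] and [s] the ranks at [i] and [i - 1]; primes refer to [k.+1]. *)
have arith (x o n n' c c' r r' s s' D E : nat) :
  (n + r = D -> n' + r' = D -> c + s = E -> c' + s' = E ->
   o + c = c' + n -> o + x = n' ->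
   x%:Z = r%:Z - s%:Z - r'%:Z + s'%:Z)%R by lia.
rewrite /Defs.omega succZ.
exact: arith (dimN k) (dimN k.+1) (capN k ik) (capN k.+1 (leqW ik)).
Qed.

(** Induction from the nullspace of the identity: each step adds one newborn space and vectors of
    the columnspace. *)
Lemma nullsp_newborns j n : (j <= L)%N -> (j + n <= L.+1)%N ->
  (nullsp (S (j + n)%N j) <=
   \sum_(p | layer j p && (p.2 == j :> nat)) newborn p.1 j +
   colsp (S j (j%:Z - 1)))%VS.
Proof.
move=> jL; elim: n => [|n IH].
  by rewrite addn0 => _; rewrite subseqmxE // prodmx_diag nullsp1 sub0v.
rewrite addnS => nL; rewrite -newborn_split ?leq_addr // /old_or_dead !subv_add.
rewrite IH ?(ltnW nL) // andbT; apply/andP; split; last first.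
  exact: subv_trans (capvSl _ _) (addvSr _ _).
have [p [kp ip]] := index_pair nL jL.
apply: subv_trans (addvSl _ _); rewrite kp; apply: (sumv_sup p) => //.
by rewrite /in_layer -kp -ip leq_addr leqnn eqxx.
Qed.

Lemma flow_forward : flows_forward L W flow_of_newborns.
Proof.
move=> k j i jL jk kL ij.
rewrite /flow_of_newborns -imgspM -prodmxS //; case: ltnP => // kj.
have -> : k = j by apply/eqP; rewrite eqn_leq kj.
(* At [k = j] the newborn space lies in the nullspace of W_{j+1~i}, so the next matrix kills its
   image. *)
apply/eqP; rewrite -subv0; apply/subvP => v /mem_imgspP[u uN ->].
have := subvP (diffvSl _ _) _ uN.
by rewrite mem_nullsp subseqmxE // memv0.
Qed.

Lemma flow_spans j : (j <= L)%N ->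
  (\sum_(p | layer j p) summand flow_of_newborns j p = fullv)%VS.
Proof.
elim/ltn_ind: j => j IH jL; apply/eqP; rewrite eqEsubv subvf /=.
(* The nullspace of W_{L+1~j} is the whole space, so newborns and the image of the previous layer
   span layer [j]. *)
have := @nullsp_newborns j (L.+1 - j).
rewrite (subnKC (leqW jL)) => /(_ jL (leqnn _)).
rewrite [S L.+1 j]subseqmx_over // nullsp0 => /subv_trans; apply.
rewrite subv_add; apply/andP; split.
  apply/subv_sumP => p /andP[jp /eqP p2]; apply: (sumv_sup p) => //.
  by rewrite /summand /flow_of_newborns p2 prodmx_diag imgsp1.
case: j jL IH => [|j] jL IH; first by rewrite /colsp imgsp0 sub0v.
rewrite predSz subseqmxE // prodmxS // prodmx_diag mulmx1.
(* The previous layer is spanned by its summands, each of which flows to a summand here or to 0. *)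
rewrite /colsp -(IH j (ltnSn j) (ltnW jL)).
rewrite /imgsp limg_sum; apply/subv_sumP => p /andP[jp pj].
rewrite -/(imgsp _ _) [imgsp _ _]flow_forward ?leq_ord //.
case: ltnP => pj'; last exact: sub0v.
by apply: (sumv_sup p); rewrite // /in_layer pj' leqW.
Qed.

Lemma sum_layer (F : nat -> nat -> int) j : (j <= L)%N ->
  \sum_(j <= t < L.+1) \sum_(0 <= s < j.+1) F t s =
  \sum_(p | layer j p) F p.1 p.2.
Proof.
move=> jL; rewrite big_geq_mkord.
under eq_bigr do rewrite big_mkord (big_ord_widen _ _ (jL : (j.+1 <= L.+1)%N)).
exact: pair_big.
Qed.

Lemma sum_dim_newborn j : (j <= L)%N ->
  (\sum_(p | layer j p) \dim (newborn p.1 p.2))%N = d j.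
Proof.
move=> jL; apply/eqP; rewrite -eqz_nat -(sum_omega_layer jL) sum_layer //.
rewrite (big_morph Posz PoszD (erefl 0%:Z)).
by apply/eqP/eq_bigr => p /andP[jp pj]; rewrite dim_newborn // (leq_trans pj).
Qed.

(** A squeeze: no image exceeds its newborn space in dimension, yet the images span dimension [d j],
    the total of the newborn dimensions. *)
Lemma dim_flow j p : (j <= L)%N -> layer j p ->
  \dim (summand flow_of_newborns j p) = \dim (newborn p.1 p.2).
Proof.
move=> jL jp; apply/eqP; rewrite eqn_leq.
have dim_le q :
    (\dim (summand flow_of_newborns j q) <= \dim (newborn q.1 q.2))%N.
  by rewrite -[leqRHS](nullsp_imgsp_dim (prodmx W j q.2)) leq_addl.
rewrite dim_le.
rewrite -(leq_add2r (\sum_(q | layer j q && (q != p)) \dim (newborn q.1 q.2))).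
rewrite -bigD1 // sum_dim_newborn //= -[leqLHS](dim_cV R) -(flow_spans jL).
apply: leq_trans (dimv_leq_sum _ _ _) _; rewrite (bigD1 p) //= leq_add2l.
by apply: leq_sum => q _; apply: dim_le.
Qed.

Lemma A_decomposition_flow : A_decomposition L W flow_of_newborns.
Proof.
split; last exact: flow_forward.
  move=> k j i ij jk kL; have jL := leq_trans jk kL.
  have [|p [kp ip]] := index_pair kL (_ : (i <= L)%N).
    exact: leq_trans jL.
  have jp : layer j p by rewrite /in_layer -kp -ip jk ij.
  by rewrite -(dim_newborn (leq_trans ij jk)) kp ip -(dim_flow jL).
apply: direct_decomposes => j jL; split; first exact: flow_spans.
rewrite directvE /= flow_spans // dim_cV -[X in X == _](sum_dim_newborn jL).
by apply/eqP/eq_bigr => p jp; rewrite -(dim_flow jL).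
Qed.

End Network.

(** * Assembly of existence, dimension formulas and duality *)

Theorem theorem12 (R : realType) (L : nat) (d : nat -> nat)
    (W : forall j : nat, 'M[R]_(d j.+1, d j))
    (hL : (1 <= L)%N) (hd : forall j : nat, (j <= L)%N -> (1 <= d j)%N) :
  (exists a b : spfamily R d,
     A_decomposition L W a /\ B_decomposition L W b)
  /\ (forall a : spfamily R d, A_decomposition L W a ->
      forall (j : nat) (k i : int), (j <= L)%N ->
        j%:Z - 1 <= k <= L%:Z -> -1 <= i <= j%:Z ->
        direct_sum_of (Asp L W k j i)
          (fun p : 'I_L.+1 * 'I_L.+1 =>
             (j%:Z <= (p.1 : nat)%:Z <= k) && (0 <= (p.2 : nat)%:Z <= i))
          (fun p => a p.1 j p.2))
  /\ (forall b : spfamily R d, B_decomposition L W b ->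
      forall (j : nat) (k i : int), (j <= L)%N ->
        j%:Z <= k <= L%:Z + 1 -> 0 <= i <= j%:Z + 1 ->
        direct_sum_of (Bsp L W k j i)
          (fun p : 'I_L.+1 * 'I_L.+1 =>
             (k <= (p.1 : nat)%:Z <= L%:Z) && (i <= (p.2 : nat)%:Z <= j%:Z))
          (fun p => b p.1 j p.2))
  /\ (forall (j : nat) (k i : int), (j <= L)%N ->
        j%:Z - 1 <= k <= L%:Z -> -1 <= i <= j%:Z ->
        (\dim (Asp L W k j i))%:Z
        = \sum_(t < L.+1 | j%:Z <= (t : nat)%:Z <= k)
            \sum_(s < L.+1 | 0 <= (s : nat)%:Z <= i) omega L W t s)
  /\ (forall (j : nat) (k i : int), (j <= L)%N ->
        j%:Z <= k <= L%:Z + 1 -> 0 <= i <= j%:Z + 1 ->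
        (\dim (Bsp L W k j i))%:Z
        = \sum_(t < L.+1 | k <= (t : nat)%:Z <= L%:Z)
            \sum_(s < L.+1 | i <= (s : nat)%:Z <= j%:Z) omega L W t s)
  /\ (forall j : nat, (j <= L)%N ->
        (d j)%:Z = \sum_(j <= t < L.+1) \sum_(0 <= s < j.+1) omega L W t s)
  /\ (forall k i : nat, (i <= k)%N -> (k <= L)%N ->
        (\rank (subseqmx L W k i))%:Z
        = \sum_(k <= t < L.+1) \sum_(0 <= s < i.+1) omega L W t s)
  /\ (forall a : spfamily R d, A_decomposition L W a ->
        B_decomposition L W (dual_family L a))
  /\ (forall b : spfamily R d, B_decomposition L W b ->
        A_decomposition L W (dual_family L b)).
Proof.
have [a Aa] : exists a, A_decomposition L W a.
  by exists (flow_of_newborns L W); apply: A_decomposition_flow.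
(* The B-spaces are obtained as duals of the A-spaces. *)
have Bb := dual_forward Aa.
(* The dimension formulas mention no decomposition, so any one serves; the index range is a product,
   which gives the double sum. *)
have dimE (c : spfamily R d) j U P Q : has_dims L W c ->
    direct_sum_of U (fun p : 'I_L.+1 * 'I_L.+1 => P p.1 && Q p.2)
      (summand c j) ->
    (forall p, P p.1 && Q p.2 -> in_layer j p) ->
    (\dim U)%:Z = \sum_(t < L.+1 | P t) \sum_(s < L.+1 | Q s) omega L W t s.
  move=> hc [<- /dim_directv->] PQ; rewrite (big_morph Posz PoszD (erefl 0%:Z)).
  rewrite pair_big; apply: eq_bigr => p /PQ; exact: dim_summand.
split; first by exists a, (dual_family L a).
split; first by move=> c Ac j k i; apply: Asp_forward.
split; first by move=> c Bc j k i; apply: Bsp_backward.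
split.
  move=> j k i jL kb ib; have [ha _ _] := Aa.
  by apply: dimE ha (Asp_forward Aa jL kb ib) _; layer_lia.
split.
  move=> j k i jL kb ib; have [hb _ _] := Bb.
  by apply: dimE hb (Bsp_backward Bb jL kb ib) _; layer_lia.
split; first by move=> j jL; rewrite sum_omega_layer.
split; first by move=> k i ik kL; rewrite sum_omega // leqW.
by split; [apply: dual_forward | apply: dual_backward].
Qed.
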